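(* There is an absolute constant $C>0$ such that the following holds. Let $A\in\mathbb{R}^{m\times n}$ with $\operatorname{rk}(A)=m$, $b\in\mathbb{R}^m$, and $P=\{x\in\mathbb{R}^n: Ax=b,\ x\ge \mathbb{0}\}$. Then the circuit diameter of $P$ is at most $C\, m\min\{m,n-m\}\log(m+\kappa_A)$.
   Context: For $W=\ker(A)$, an elementary vector is a nonzero $g\in W$ whose support is minimal, i.e. there is no $h\in W\setminus\{\mathbb{0}\}$ with $\mathrm{supp}(h)\subsetneq\mathrm{supp}(g)$; $\mathcal E(A)$ denotes the set of elementary vectors. The circuit imbalance measure is $\kappa_A=\max\{|g_i|/|g_j| : g\in\mathcal E(A),\ i,j\in\mathrm{supp}(g)\}$. A circuit walk in $P$ is a sequence $x^{(1)},\dots,x^{(k+1)}\in P$ such that for each $i$, $x^{(i+1)}=x^{(i)}+g^{(i)}$ with $g^{(i)}\in\mathcal E(A)$ and $x^{(i)}+(1+\varepsilon)g^{(i)}\notin P$ for every $\varepsilon>0$ (each step is maximal); its length is $k$. The circuit diameter of $P$ is the maximum, over all ordered pairs of vertices $x,y$ of $P$, of the minimum length of a circuit walk from $x$ to $y$. *)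

(* Defs.v *)
From HB Require Import structures.
From mathcomp Require Import all_boot all_order all_algebra.
From mathcomp Require Import boolp classical_sets reals exp Rstruct.
Notation R := Rdefinitions.R.
Set Implicit Arguments. Unset Strict Implicit. Unset Printing Implicit Defensive.
Import Order.TTheory GRing.Theory Num.Theory.
Local Open Scope ring_scope.

Section CircuitDefs.
Variables (m n : nat) (A : 'M[R]_(m, n)) (b : 'cV[R]_m).

Definition inP (x : 'cV[R]_n) : Prop := A *m x = b /\ forall i, 0 <= x i 0.

Definition supp (g : 'cV[R]_n) : {set 'I_n} := [set i | g i 0 != 0].

Definition elementary (g : 'cV[R]_n) : Prop :=
  A *m g = 0 /\ g != 0 /\
  ~ (exists h : 'cV[R]_n, A *m h = 0 /\ h != 0 /\ supp h \proper supp g).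

(* circuit imbalance measure kappa_A (max over a finite set of ratios,
   taken as the supremum of that set) *)
Definition kappa : R :=
  sup [set r : R | exists g : 'cV[R]_n, exists i j : 'I_n,
         [/\ elementary g, i \in supp g, j \in supp g & r = `|g i 0| / `|g j 0|] ]%classic.

Definition vertex (x : 'cV[R]_n) : Prop :=
  inP x /\ forall y z t, inP y -> inP z -> 0 < t -> t < 1 ->
    x = t *: y + (1 - t) *: z -> y = z.

(* circuit walk x^(1..k+1) encoded as xs 0 .. xs k, of length k *)
Definition circuit_walk (k : nat) (xs : nat -> 'cV[R]_n) : Prop :=
  (forall i, (i <= k)%N -> inP (xs i)) /\
  forall i, (i < k)%N -> exists g : 'cV[R]_n,
    [/\ elementary g, xs i.+1 = xs i + g &
        forall eps : R, 0 < eps -> ~ inP (xs i + (1 + eps) *: g)].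

Definition circuit_diameter_le (B : R) : Prop :=
  forall x y, vertex x -> vertex y ->
    exists k xs, [/\ circuit_walk k xs, xs 0%N = x, xs k = y & (k%:R : R) <= B].

End CircuitDefs.

(* Main.v *)
Require Import Defs.
From HB Require Import structures.
From mathcomp Require Import all_boot all_order all_algebra.
From mathcomp Require Import boolp classical_sets reals sequences exp Rstruct.
From mathcomp Require Import lra ring zify.
Set Implicit Arguments.
Unset Strict Implicit.
Unset Printing Implicit Defensive.
Import Order.TTheory GRing.Theory Num.Theory.
Local Open Scope ring_scope.

(* Let y be the target vertex and f(x) the sum of x_j over the j with y_j = 0.
   Decompose y - x conformally into at most D = 2 min(m, n - m) circuits and
   augment maximally along the circuit g with the largest f(-g): this shrinks f
   by a factor 1 - 1/D and uses a step length in [1, D].  Moreover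
   |x_i - y_i| <= kappa f(x).  Three index sets only shrink along the walk:
   the j with y_j = 0 < x_j, the i with 0 < y_i <= kappa f(x) and the i with
   y_i > 0 and x_i > D y_i.  If the coordinate i that drops to 0 in a step is in
   the first or the third set, then it leaves that set.  Otherwise
   f(x) <= D^2 m kappa y_i, and O(D log (m + kappa)) further steps make f small
   enough for i to leave the second set.  The three sets have at most 3m elements
   in total. *)

(** Multiplying by [b ^+ 2 > 0] turns the claim into the product of the two hypotheses. *)
Lemma mulr_ge0_trans (F : realFieldType) (a b c : F) :
  b != 0 -> 0 <= a * b -> 0 <= b * c -> 0 <= a * c.
Proof.
move=> b0 ab bc; have b2 : 0 < b ^+ 2 by rewrite exprn_even_gt0.
rewrite -(pmulr_rge0 _ b2); have -> : b ^+ 2 * (a * c) = (a * b) * (b * c) by ring.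
exact: mulr_ge0.
Qed.

(** * Sign-compatible circuits inside a kernel vector *)

Section Conformal.
Variable n : nat.
Implicit Types g h z x w : 'cV[R]_n.

Lemma in_supp g i : (i \in supp g) = (g i 0 != 0).
Proof. by rewrite inE. Qed.

Lemma supp_scale (c : R) g : c != 0 -> supp (c *: g) = supp g.
Proof. by move=> c0; apply/setP => i; rewrite !in_supp mxE mulf_eq0 (negPf c0). Qed.

Lemma supp_opp g : supp (- g) = supp g.
Proof. by apply/setP => i; rewrite !in_supp mxE oppr_eq0. Qed.

Lemma supp_neq0P g : reflect (exists i, g i 0 != 0) (g != 0).
Proof.
apply: (iffP idP) => [g0|[i gi]]; last by apply: contraNneq gi => ->; rewrite mxE.
apply/existsP; apply: contraNT g0; rewrite negb_exists => /forallP g0.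
by apply/eqP/matrixP => i j; rewrite ord1 mxE; apply/eqP; rewrite -[_ == _]negbK g0.
Qed.

(** A ratio test: [l] is the least [z_i / g_i] over the coordinates where the signs agree. It serves
    to cancel a coordinate and, later, to find the maximal step length. *)
Lemma max_scaling g z : (exists i, 0 < g i 0 * z i 0) ->
  exists (l : R) i, [/\ 0 < l, 0 < g i 0 * z i 0, l * g i 0 = z i 0 &
    forall j, 0 < g j 0 * z j 0 -> l * `|g j 0| <= `|z j 0|].
Proof.
case=> i0 Hi0.
have [i Hi Hmin] := @arg_minP _ R 'I_n i0 (fun i => 0 < g i 0 * z i 0)
  (fun i => z i 0 / g i 0) Hi0.
have gn0 j : 0 < g j 0 * z j 0 -> g j 0 != 0.
  by apply: contraTneq => ->; rewrite mul0r ltxx.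
have q_gt0 j : 0 < g j 0 * z j 0 -> 0 < z j 0 / g j 0.
  move=> Hj; have -> : z j 0 / g j 0 = (g j 0 * z j 0) / g j 0 ^+ 2.
    by field; exact: gn0.
  by rewrite divr_gt0 // exprn_even_gt0 // gn0.
exists (z i 0 / g i 0), i; split => //; first exact: q_gt0.
  by rewrite divfK // gn0.
move=> j Hj; have := Hmin j Hj.
have -> : `|z j 0| = z j 0 / g j 0 * `|g j 0|.
  by rewrite -[X in X * _]gtr0_norm ?q_gt0 // normrM normfV divfK // normr_eq0 gn0.
exact: ler_wpM2r.
Qed.

Definition conformal g z := forall i, 0 <= g i 0 * z i 0 /\ `|g i 0| <= `|z i 0|.

Lemma conformal_trans h g z : conformal g h -> conformal h z -> conformal g z.
Proof.
move=> gh hz i; have [gh1 gh2] := gh i; have [hz1 hz2] := hz i.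
split; last exact: le_trans hz2.
have [h0|h0] := eqVneq (h i 0) 0.
  by move: gh2; rewrite h0 normr0 normr_le0 => /eqP ->; rewrite mul0r.
exact: mulr_ge0_trans h0 gh1 hz1.
Qed.

Lemma conformal_supp g z : conformal g z -> supp g \subset supp z.
Proof.
move=> gz; apply/fintype.subsetP => i; rewrite !in_supp; apply: contraNneq => zi.
by have [_] := gz i; rewrite zi normr0 normr_le0.
Qed.

Lemma conformalB g z : conformal g z -> conformal (z - g) z.
Proof.
move=> gz i; have [s a] := gz i; rewrite !mxE.
case: (ltrgt0P (z i 0)) => [zi|zi|zi].
- have gi : 0 <= g i 0 by move: s; rewrite pmulr_lge0.
  move: a; rewrite (gtr0_norm zi) ger0_norm // => a.
  by rewrite ger0_norm ?mulr_ge0 ?(ltW zi) ?subr_ge0 // gerBl.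
- have gi : g i 0 <= 0 by move: s; rewrite nmulr_lge0.
  move: a; rewrite (ltr0_norm zi) ler0_norm // lerN2 => a.
  by rewrite ler0_norm ?mulr_le0 ?(ltW zi) ?subr_le0 // lerN2 lerDl oppr_ge0.
- by move: a; rewrite zi normr0 normr_le0 => /eqP ->; rewrite subr0 normr0 mulr0.
Qed.

Variables (m : nat) (A : 'M[R]_(m, n)).

Lemma elementary_scale (c : R) g : c != 0 -> elementary A g -> elementary A (c *: g).
Proof.
move=> c0 [Ag [g0 gmin]]; split; first by rewrite -scalemxAr Ag scaler0.
by rewrite scaler_eq0 (negPf c0) supp_scale.
Qed.

(** Induction on the support size: if [z] is not elementary, subtracting a suitable multiple of a
    kernel vector [h] of smaller support kills a coordinate of [z] and flips no sign. *)
Lemma conformal_elementary z : A *m z = 0 -> z != 0 ->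
  exists g, [/\ elementary A g, supp g \subset supp z & forall i, 0 <= g i 0 * z i 0].
Proof.
have [k] := ubnP #|supp z|; elim: k z => // k IH z; rewrite ltnS => leK Az z0.
have [zE|zE] := pselect (elementary A z).
  by exists z; split=> // i; rewrite -expr2 sqr_ge0.
have [h [Ah h0 hz [i hi]]] : exists h, [/\ A *m h = 0, h != 0,
    supp h \proper supp z & exists i, 0 < h i 0 * z i 0].
  have [h [Ah [h0 hz]]] : exists h, A *m h = 0 /\ h != 0 /\ supp h \proper supp z.
    by apply: contrapT => H; apply: zE.
  have /supp_neq0P[i hi] := h0.
  have zi : z i 0 != 0.
    by have /properP[/fintype.subsetP/(_ i)] := hz; rewrite !in_supp => /(_ hi).
  have [p|p|/eqP] := ltrgt0P (h i 0 * z i 0).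
  - by exists h; split=> //; exists i.
  - exists (- h); split; rewrite ?mulmxN ?Ah ?oppr0 ?oppr_eq0 ?supp_opp //.
    by exists i; rewrite mxE mulNr oppr_gt0.
  - by rewrite mulf_eq0 (negPf hi) (negPf zi).
have [l [j [l0 hj lj lmin]]] := max_scaling (ex_intro _ i hi).
(* Where the signs of [h] and [z] disagree, subtracting [l *: h] moves away from 0; where they
   agree, minimality of [l] prevents crossing 0. *)
have lh_conf k' : 0 <= (z - l *: h) k' 0 * z k' 0.
  rewrite !mxE mulrBl.
  have [p|p] := ltP 0 (h k' 0 * z k' 0); last first.
    rewrite subr_ge0 -mulrA; apply: (@le_trans _ _ 0); first by rewrite pmulr_rle0.
    by rewrite -expr2 sqr_ge0.
  rewrite subr_ge0 -mulrA -(gtr0_norm p) normrM mulrA -expr2 -real_normK ?num_real //.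
  by rewrite expr2; apply: ler_wpM2r => //; exact: lmin.
have sub : supp (z - l *: h) \proper supp z.
  apply/properP; split.
    apply/fintype.subsetP => k'; rewrite !in_supp !mxE; apply: contraNneq => zk.
    have /properP[/fintype.subsetP/(_ k')] := hz; rewrite !in_supp zk eqxx.
    by case: eqVneq => [-> _ _|_ /(_ isT)//]; rewrite mulr0 subr0.
  exists j; first by rewrite in_supp; apply: contraTneq hj => ->; rewrite mulr0 ltxx.
  by rewrite in_supp !mxE lj subrr eqxx.
have nz : z - l *: h != 0.
  rewrite subr_eq0; apply: contraTneq hz => ->.
  by rewrite supp_scale ?fintype.properxx // gt_eqF.
have [||//|g [gE gs gc]] := IH (z - l *: h).
- exact: leq_trans (proper_card sub) leK.
- by rewrite mulmxBr Az -scalemxAr Ah scaler0 subr0.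
exists g; split=> //; first exact: fintype.subset_trans gs (proper_sub sub).
move=> k'; have [w0|w0] := eqVneq ((z - l *: h) k' 0) 0.
  have /fintype.subsetP/(_ k') := gs; rewrite !in_supp w0 eqxx.
  by case: eqVneq => [->|_ /(_ isT)//]; rewrite mul0r.
exact: mulr_ge0_trans w0 (gc k') (lh_conf k').
Qed.

(** Scale a sign-compatible circuit as far as [z] allows. Equality at [i] makes this coordinate
    vanish in [z - g]. *)
Lemma conformal_circuit z : A *m z = 0 -> z != 0 ->
  exists g i, [/\ elementary A g, conformal g z, z i 0 != 0 & g i 0 = z i 0].
Proof.
move=> Az z0; have [g [gE gs gc]] := conformal_elementary Az z0.
have gz_gt0 i : g i 0 != 0 -> 0 < g i 0 * z i 0.
  move=> gi; rewrite lt_def gc andbT mulf_neq0 //.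
  by have /fintype.subsetP/(_ i) := gs; rewrite !in_supp => ->.
have [_ [/supp_neq0P[i gi] _]] := gE.
have [l [j [l0 gj lj lmin]]] := max_scaling (ex_intro _ i (gz_gt0 _ gi)).
exists (l *: g), j; split; last by rewrite mxE.
- by apply: elementary_scale => //; rewrite gt_eqF.
- move=> k; rewrite mxE -mulrA; split; first by rewrite pmulr_rge0.
  rewrite normrM gtr0_norm //; have [->|gk] := eqVneq (g k 0) 0; first by rewrite normr0 mulr0.
  by apply: lmin; exact: gz_gt0.
- by apply: contraTneq gj => ->; rewrite mulr0 ltxx.
Qed.

End Conformal.

(** * Conformal decomposition, circuit imbalance and vertices *)

Section Decomposition.
Variables (m n : nat) (A : 'M[R]_(m, n)).
Implicit Types g h z x w : 'cV[R]_n.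
Implicit Types S T : {set 'I_n}.

(* Its row space consists of the [w] with [A w^T = 0] and support in [S]. *)
Definition kerS S : 'M[R]_n :=
  kermx (row_mx A^T (\matrix_(i < n, k < #|~: S|) (i == enum_val k)%:R)).

Lemma sub_kerSP S z : reflect (A *m z = 0 /\ supp z \subset S) (z^T <= kerS S)%MS.
Proof.
apply: (iffP sub_kermxP); rewrite mul_mx_row -trmx_mul.
  rewrite -row_mx0 => /eq_row_mx[Az zE]; split; first by apply: trmx_inj; rewrite Az trmx0.
  apply/fintype.subsetP => i; rewrite in_supp; apply: contraNT => iS.
  have iC : i \in ~: S by rewrite inE.
  have /matrixP/(_ 0 (enum_rank_in iC i)) := zE.
  rewrite !mxE (bigD1 i) //= !mxE enum_rankK_in // eqxx mulr1 big1 ?addr0; last first.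
    by move=> j ji; rewrite !mxE enum_rankK_in // (negPf ji) mulr0.
  by move=> ->.
case=> -> /fintype.subsetP sz; rewrite trmx0 -row_mx0; congr row_mx.
apply/matrixP => i k; rewrite ord1 !mxE big1 // => j _; rewrite !mxE.
case: eqVneq => [->|_]; last by rewrite mulr0.
apply/eqP; rewrite mulr1; apply: contraTT (enum_valP k) => zk.
by rewrite inE negbK; apply: sz; rewrite in_supp.
Qed.

Lemma kerS_subP S r (B : 'M[R]_(r, n)) :
  reflect (forall i, A *m (row i B)^T = 0 /\ supp (row i B)^T \subset S) (B <= kerS S)%MS.
Proof.
apply: (iffP row_subP) => H i; first by apply/sub_kerSP; rewrite trmxK.
by rewrite -[row i B]trmxK; apply/sub_kerSP.
Qed.

(** The vector [g] itself separates the two spaces. *)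
Lemma kerS_proper S T g : A *m g = 0 -> S \subset T -> supp g \subset T ->
  ~~ (supp g \subset S) -> (\rank (kerS S) < \rank (kerS T))%N.
Proof.
move=> Ag ST gT gS; apply: rank_ltmx; rewrite ltmxE; apply/andP; split.
  apply/kerS_subP => i; have /kerS_subP/(_ i)[-> sS] := submx_refl (kerS S).
  by split=> //; exact: fintype.subset_trans sS ST.
apply: contra gS => TS.
have /(submx_trans)/(_ TS)/sub_kerSP[] // : (g^T <= kerS T)%MS by apply/sub_kerSP.
Qed.

Lemma rank_kerS S : (\rank (kerS S) <= n - \rank A)%N.
Proof.
rewrite -(mxrank_tr A) -mxrank_ker; apply: mxrankS; apply/sub_kermxP.
apply/row_matrixP => i; rewrite row_mul row0.
have /kerS_subP/(_ i)[AK _] := submx_refl (kerS S).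
by apply: trmx_inj; rewrite trmx_mul trmxK AK trmx0.
Qed.

(** Peel off a circuit [g] that equals [z] at some [i]. Then [i] leaves the support, and [g] leaves
    the space of kernel vectors supported there, so cardinality and dimension both drop. *)
Lemma conformal_decomposition z : A *m z = 0 ->
  exists gs : seq 'cV[R]_n,
    [/\ forall g, g \in gs -> elementary A g /\ conformal g z,
        z = (\sum_(g <- gs) g),
        (size gs <= #|supp z|)%N & (size gs <= \rank (kerS (supp z)))%N].
Proof.
have [k] := ubnP #|supp z|; elim: k z => // k IH z; rewrite ltnS => leK Az.
have [->|z0] := eqVneq z 0; first by exists [::]; split; rewrite ?big_nil.
have [g [i [gE gz zi gi]]] := conformal_circuit Az z0.
have [Ag _] := gE.
have zgz := conformalB gz.
have szg := conformal_supp zgz.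
have iszg : i \notin supp (z - g) by rewrite in_supp !mxE gi subrr eqxx.
have lt_supp : (#|supp (z - g)| < #|supp z|)%N.
  apply: proper_card; apply/fintype.properP; split=> //; exists i => //.
  by rewrite in_supp.
have [||gs [gsE zE s1 s2]] := IH (z - g).
- exact: leq_trans lt_supp leK.
- by rewrite mulmxBr Az Ag subr0.
exists (g :: gs); split.
- move=> h; rewrite in_cons => /orP[/eqP ->|/gsE[hE hz]] //; split=> //.
  exact: conformal_trans hz zgz.
- by rewrite big_cons -zE addrC subrK.
- exact: leq_ltn_trans s1 lt_supp.
- apply: leq_ltn_trans s2 _; apply: kerS_proper Ag szg (conformal_supp gz) _.
  apply/negP => /fintype.subsetP/(_ i); rewrite !in_supp !mxE gi subrr zi eqxx.
  by move=> /(_ isT).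
Qed.

(** Cancelling coordinate [i] leaves a kernel vector of strictly smaller support, which must be
    0. *)
Lemma elementary_unique g h : elementary A g -> elementary A h -> supp g = supp h ->
  exists c, g = c *: h.
Proof.
move=> [Ag [/supp_neq0P[i gi] gmin]] [Ah _] sgh.
have hi : h i 0 != 0 by rewrite -in_supp -sgh in_supp.
exists (g i 0 / h i 0); apply/eqP; rewrite -subr_eq0; apply/negPn/negP => nz.
apply: gmin; exists (g - (g i 0 / h i 0) *: h); split.
  by rewrite mulmxBr -scalemxAr Ag Ah scaler0 subr0.
split=> //; apply/fintype.properP; split.
  apply/fintype.subsetP => j; rewrite !in_supp !mxE; apply: contraNneq => gj.
  have : j \notin supp h by rewrite -sgh in_supp gj eqxx.
  by rewrite in_supp negbK => /eqP ->; rewrite gj mulr0 subr0.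
by exists i; rewrite !in_supp // !mxE divfK // subrr eqxx.
Qed.

(** Ratios depend only on the support of the circuit and on [i, j], so finitely many occur and their
    sum is a bound. This makes the [sup] in [kappa] meaningful. *)
Lemma kappa_has_ubound : has_ubound [set r : R | exists g : 'cV[R]_n, exists i j : 'I_n,
  [/\ elementary A g, i \in supp g, j \in supp g & r = `|g i 0| / `|g j 0|] ]%classic.
Proof.
(* One representative circuit per support; on sets that support no circuit, [f] is unconstrained. *)
have /choice[f fP] : forall S, exists g : 'cV[R]_n,
    (exists2 h, elementary A h & supp h = S) -> elementary A g /\ supp g = S.
  move=> S; have [[h hE hS]|H] := pselect (exists2 h, elementary A h & supp h = S).
    by exists h.
  by exists 0 => /H.
pose F S (i j : 'I_n) : R := `|f S i 0| / `|f S j 0|.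
have F0 S i j : 0 <= F S i j by rewrite divr_ge0.
exists (\sum_S \sum_i \sum_j F S i j) => r /= [g [i [j [gE gi gj ->]]]].
have [fE fS] := fP (supp g) (ex_intro2 _ _ g gE erefl).
have [c gc] := elementary_unique gE fE (esym fS).
have c0 : c != 0.
  by apply: contraTneq gi => c0; rewrite in_supp gc c0 scale0r mxE eqxx.
have -> : `|g i 0| / `|g j 0| = F (supp g) i j.
  by rewrite {1 2}gc !mxE !normrM -mulf_div divff ?mul1r // normr_eq0.
rewrite (bigD1 (supp g)) //= (bigD1 i) //= (bigD1 j) //= -!addrA lerDl.
rewrite !addr_ge0 // !sumr_ge0 // => *; rewrite !sumr_ge0 // => *.
by rewrite sumr_ge0.
Qed.

Lemma le_kappa g i j : elementary A g -> i \in supp g -> j \in supp g ->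
  `|g i 0| <= kappa A * `|g j 0|.
Proof.
move=> gE gi gj; rewrite -ler_pdivrMr ?normr_gt0 -?in_supp //.
by apply: (ub_le_sup kappa_has_ubound); exists g, i, j.
Qed.

Lemma kappa_ge0 : 0 <= kappa A.
Proof.
rewrite /kappa; set K := [set r | _]%classic.
(* Without circuits the set is empty, and its [sup] is 0 by convention. *)
have [->|/set0P[r Kr]] := eqVneq K set0; first by rewrite sup0.
apply: (@le_trans _ _ r); last exact: (ub_le_sup kappa_has_ubound).
by case: Kr => g [i [j [_ _ _ ->]]]; rewrite divr_ge0.
Qed.

Lemma kappa_ge1 g : elementary A g -> 1 <= kappa A.
Proof.
move=> gE; have [_ [/supp_neq0P[i gi] _]] := gE.
have := @le_kappa g i i gE; rewrite in_supp gi => /(_ isT isT).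
by rewrite -ler_pdivrMr ?divff ?normr_gt0 ?normr_eq0.
Qed.

Variable b : 'cV[R]_m.

(** A small multiple of [w] can be added to and subtracted from [x] inside P; [x] is the midpoint,
    so extremality forces [w = 0]. *)
Lemma vertex_ker x w : vertex A b x -> A *m w = 0 -> supp w \subset supp x -> w = 0.
Proof.
move=> [[Ax x0] xv] Aw /fintype.subsetP swx.
(* The 1 makes [s] positive, and the i-th summand ensures [|w_i| / s <= x_i]. If [x_i = 0], then
   [w_i = 0] and the quotient is 0 by convention. *)
pose s := 1 + \sum_i `|w i 0| / x i 0.
have q0 i : 0 <= `|w i 0| / x i 0 by rewrite divr_ge0.
have s0 : 0 < s by rewrite ltr_pwDl // sumr_ge0.
have wx i : `|s^-1 * w i 0| <= x i 0.
  rewrite normrM gtr0_norm ?invr_gt0 // mulrC ler_pdivrMr //.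
  have [xi|xi] := eqVneq (x i 0) 0.
    have : i \notin supp w by apply/negP => /swx; rewrite in_supp xi eqxx.
    by rewrite in_supp negbK => /eqP ->; rewrite normr0 mulr_ge0 // ltW.
  have xi0 : 0 < x i 0 by rewrite lt_def xi x0.
  rewrite -ler_pdivrMl // mulrC /s (bigD1 i) //= addrCA lerDl addr_ge0 // sumr_ge0 //.
have inPw : inP A b (x + s^-1 *: w).
  split; first by rewrite mulmxDr -scalemxAr Aw scaler0 addr0.
  by move=> i; rewrite !mxE; have := wx i; rewrite ler_norml; lra.
have inPw' : inP A b (x - s^-1 *: w).
  split; first by rewrite mulmxBr -scalemxAr Aw scaler0 subr0.
  by move=> i; rewrite !mxE; have := wx i; rewrite ler_norml; lra.
have /eqP : x + s^-1 *: w = x - s^-1 *: w.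
  apply: (xv _ _ 2^-1 inPw inPw'); [lra | lra |].
  by apply/matrixP => i j; rewrite !mxE; lra.
rewrite -subr_eq0 opprB addrCA (addrC x) addrK -mulr2n -scaler_nat !scaler_eq0 pnatr_eq0 /=.
by rewrite invr_eq0 gt_eqF // => /eqP.
Qed.

(** A zero kernel means that the n rows of the matrix defining [kerS] are independent, so n is at
    most its number of columns, [m + (n - |supp x|)]. *)
Lemma vertex_supp x : vertex A b x -> (#|supp x| <= m)%N.
Proof.
move=> xv; have /eqP : kerS (supp x) = 0.
  apply/row_matrixP => i; rewrite row0; apply: trmx_inj; rewrite trmx0.
  by have /kerS_subP/(_ i)[] := submx_refl (kerS (supp x)); exact: vertex_ker.
rewrite -mxrank_eq0 mxrank_ker subn_eq0 => /leq_trans/(_ (rank_leq_col _)).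
by rewrite -{1}[n]card_ord -(cardsC (supp x)) leq_add2r.
Qed.

End Decomposition.

(** * One maximal augmentation towards the target vertex *)

Section Steps.
Variables (m n : nat) (A : 'M[R]_(m, n)) (b : 'cV[R]_m) (y : 'cV[R]_n).
Variables (rkA : \rank A = m) (yv : vertex A b y).
Implicit Types g h z x w : 'cV[R]_n.

Let yP : inP A b y := yv.1.

(** The function f of the overview, extended linearly to all vectors, so that f(y - x) = -f(x). *)
Definition offsum g : R := \sum_(j | y j 0 == 0) g j 0.
Let D : nat := (2 * minn m (n - m))%N.
Definition offsupp x := supp x :\: supp y.
(* Coordinates in [supp y] but not in [small] stay positive for the rest of the walk, by
   [proximity]. *)
Definition small x := [set i in supp y | y i 0 <= kappa A * offsum x].
(** The factor D matches the longest possible step, so no new coordinate can enter this set. *)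
Definition large x := [set i in supp y | D%:R * y i 0 < x i 0].
Definition potential x := (#|offsupp x| + #|small x| + #|large x|)%N.

Lemma offsum_ge0 x : inP A b x -> 0 <= offsum x.
Proof. by move=> [_ x0]; apply: sumr_ge0. Qed.

Lemma offsumD g h : offsum (g + h) = offsum g + offsum h.
Proof. by rewrite /offsum -big_split; apply: eq_bigr => j _; rewrite mxE. Qed.

Lemma offsumZ (c : R) g : offsum (c *: g) = c * offsum g.
Proof. by rewrite /offsum mulr_sumr; apply: eq_bigr => j _; rewrite mxE. Qed.

Lemma offsum_sum (gs : seq 'cV[R]_n) : offsum (\sum_(g <- gs) g) = \sum_(g <- gs) offsum g.
Proof.
elim: gs => [|g gs IH]; last by rewrite !big_cons offsumD IH.
by rewrite !big_nil /offsum big1 // => j _; rewrite mxE.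
Qed.

Lemma offsum_y : offsum y = 0.
Proof. by rewrite /offsum big1 // => j /eqP. Qed.

Lemma offsum_sub x : offsum (y - x) = - offsum x.
Proof. by rewrite -scaleN1r offsumD offsumZ offsum_y add0r mulN1r. Qed.

(** Otherwise the circuit would be a kernel vector supported in [supp y], hence 0. *)
Lemma elementary_off g : elementary A g -> exists2 j, g j 0 != 0 & y j 0 = 0.
Proof.
move=> [Ag [g0 _]]; apply: contrapT => H; move/eqP: g0; apply; apply: (vertex_ker yv Ag).
apply/fintype.subsetP => j; rewrite !in_supp => gj; apply/eqP => yj; apply: H.
by exists j.
Qed.

(** Linear form of conformality with [d = y_i - x_i], suited to [lra]. *)
Variant conformal_coord (a d : R) : Prop :=
| ConformalUp of 0 <= a & a <= d
| ConformalDown of d <= a & a <= 0.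

Lemma conformalP g x i : conformal g (y - x) ->
  conformal_coord (g i 0) (y i 0 - x i 0).
Proof.
move=> /(_ i); rewrite !mxE => -[s].
have [d0|d0|->] := ltrgt0P (y i 0 - x i 0).
- have gi : 0 <= g i 0 by move: s; rewrite pmulr_lge0.
  by rewrite ger0_norm // => ?; left.
- have gi : g i 0 <= 0 by move: s; rewrite nmulr_lge0.
  by rewrite ler0_norm // lerN2 => ?; right.
- by rewrite normr_le0 => /eqP ->; left.
Qed.

Lemma conformal_off_le0 g x j : inP A b x -> conformal g (y - x) -> y j 0 = 0 -> g j 0 <= 0.
Proof.
by move=> [_ /(_ j) x0] /(conformalP j) []; move=> *; lra.
Qed.

(** Some entry [g_j] with [y_j = 0] is nonzero; all such entries are nonpositive, so
    [|g_j| <= -f(g)], and [kappa] compares [g_i] with [g_j]. *)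
Lemma circuit_le_offsum g x i : inP A b x -> elementary A g -> conformal g (y - x) ->
  `|g i 0| <= kappa A * - offsum g.
Proof.
move=> xP gE gc; have [j gj yj] := elementary_off gE.
have k0 := kappa_ge0 A.
have le_off : `|g j 0| <= - offsum g.
  rewrite /offsum (bigD1 j) ?yj //= opprD ler0_norm ?(conformal_off_le0 xP gc yj) //.
  rewrite lerDl oppr_ge0 sumr_le0 // => k /andP[/eqP yk _].
  exact: conformal_off_le0 xP gc yk.
have [->|gi] := eqVneq (g i 0) 0.
  by rewrite normr0 mulr_ge0 // (le_trans _ le_off).
apply: le_trans (le_kappa gE (_ : i \in supp g) (_ : j \in supp g)) _; rewrite ?in_supp //.
exact: ler_wpM2l.
Qed.

(** Sum [circuit_le_offsum] over a conformal decomposition of [y - x]. *)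
Lemma proximity x i : inP A b x -> `|x i 0 - y i 0| <= kappa A * offsum x.
Proof.
move=> xP; have Az : A *m (y - x) = 0 by rewrite mulmxBr yP.1 xP.1 subrr.
have [gs [gsE zE _ _]] := conformal_decomposition Az.
rewrite -[offsum x]opprK -offsum_sub zE offsum_sum -sumrN mulr_sumr.
have -> : `|x i 0 - y i 0| = `|\sum_(g <- gs) g i 0|.
  by rewrite distrC; have := congr1 (fun u : 'cV[R]_n => u i 0) zE; rewrite !mxE summxE => ->.
apply: le_trans (ler_norm_sum _ _ _) _; rewrite big_seq [leRHS]big_seq.
by apply: ler_sum => g /gsE[gE gc]; exact: circuit_le_offsum xP gE gc.
Qed.

Lemma offsum_eq0 x : inP A b x -> offsum x = 0 -> x = y.
Proof.
move=> xP x0; apply/matrixP => i j; rewrite ord1; apply/eqP.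
by rewrite -subr_eq0 -normr_le0; have := proximity i xP; rewrite x0 mulr0.
Qed.

(** Intermediate points need not be vertices, so the support bound is carried along as an
    invariant. *)
Definition admissible x := inP A b x /\ (#|offsupp x| <= m)%N.

(** Averaging: at most D circuits share the total decrease f(x), so one of them has at least
    f(x)/D. *)
Lemma exists_long_circuit x : admissible x -> x <> y -> (0 < D)%N /\
  exists g, [/\ elementary A g, conformal g (y - x) & offsum x <= D%:R * - offsum g].
Proof.
move=> [xP Um] xy.
have Az : A *m (y - x) = 0 by rewrite mulmxBr yP.1 xP.1 subrr.
have [gs [gsE zE s1 s2]] := conformal_decomposition Az.
have sD : (size gs <= D)%N.
  (* The two bounds n - m and 2m on the number of circuits together give D. *)
  have h1 : (size gs <= n - m)%N by rewrite -[in X in (_ - X)%N]rkA (leq_trans s2) ?rank_kerS.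
  have h2 : (size gs <= m + m)%N.
    apply: leq_trans s1 _; apply: leq_trans (leq_add (vertex_supp yv) Um).
    apply: leq_trans (leq_card_setU _ _); apply/subset_leq_card/fintype.subsetP => i.
    rewrite !inE !mxE; apply: contraR; rewrite negb_or negb_and !negbK.
    by case: eqVneq => [->|//] /= /eqP ->; rewrite subrr.
  by rewrite /D; lia.
have gs0 : gs != [::].
  apply/eqP => gs0; apply: xy; apply/eqP; rewrite eq_sym -subr_eq0.
  by rewrite zE gs0 big_nil.
have s0 : (0 < size gs)%N by rewrite lt0n size_eq0.
split; first exact: leq_trans s0 sD.
have [/hasP[g gin gl]|/hasPn H] :=
    boolP (has (fun g => offsum x <= D%:R * - offsum g) gs).
  by exists g; have [] := gsE g gin.
have : D%:R * offsum x < (size gs)%:R * offsum x.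
  rewrite -[in X in X < _](opprK (offsum x)) -offsum_sub zE offsum_sum -sumrN mulr_sumr.
  have -> : (size gs)%:R * offsum x = \sum_(g <- gs) offsum x.
    by rewrite big_const_seq count_predT iter_addr_0 mulr_natl.
  rewrite big_seq [ltRHS]big_seq; apply: ltr_sum.
    by case: gs gs0 {gsE zE s1 s2 sD s0 H} => //= g gs _; rewrite mem_head.
  by move=> g /H; rewrite -ltNge.
by rewrite ltNge ler_wpM2r ?offsum_ge0 // ler_nat.
Qed.

Lemma exists_max_step x g : inP A b x -> elementary A g -> conformal g (y - x) ->
  exists (a : R) i, [/\ 1 <= a, inP A b (x + a *: g), g i 0 < 0 & x i 0 + a * g i 0 = 0].
Proof.
move=> xP gE gc; have [_ x0] := xP; have [_ y0] := yP.
have x_gt0 j : g j 0 < 0 -> 0 < x j 0.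
  by have := y0 j; case: (conformalP j gc) => *; lra.
(* A decreasing coordinate exists, so the ratio test on [-g] and [x] has a candidate. *)
have [j gj yj] := elementary_off gE.
have gj0 : g j 0 < 0 by rewrite lt_neqAle gj (conformal_off_le0 xP gc yj).
have [a [i [a0 gi ai amin]]] : exists (l : R) i, [/\ 0 < l, 0 < (- g) i 0 * x i 0,
    l * (- g) i 0 = x i 0 & forall j, 0 < (- g) j 0 * x j 0 -> l * `|(- g) j 0| <= `|x j 0|].
  apply: max_scaling; exists j; rewrite mxE mulr_gt0 ?oppr_gt0 //; exact: x_gt0.
rewrite mxE in ai gi.
have gi0 : g i 0 < 0.
  by rewrite -oppr_gt0 ltNge; apply: contraTN gi => gi; rewrite -leNgt mulr_le0_ge0.
exists a, i; split=> //; last by rewrite -ai; ring.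
(* If [a < 1], then [x_i = -a g_i < -g_i <= x_i - y_i <= x_i]. *)
- rewrite leNgt; apply/negP => a1.
  have : 0 < - g i 0 * (1 - a) by apply: mulr_gt0; lra.
  have := y0 i; case: (conformalP i gc) => *; first lra.
  have E : - g i 0 * (1 - a) = - g i 0 - a * - g i 0 by ring.
  lra.
- split; first by rewrite mulmxDr -scalemxAr gE.1 scaler0 addr0 xP.1.
  move=> k; rewrite !mxE; have [gk|gk] := ltP (g k 0) 0; last first.
    by rewrite addr_ge0 // mulr_ge0 // ltW.
  have := amin k; rewrite !mxE mulr_gt0 ?oppr_gt0 ?x_gt0 // => /(_ isT).
  by rewrite normrN ltr0_norm // (ger0_norm (x0 k)); lra.
Qed.

Definition cstep x x' := exists g, [/\ elementary A g, x' = x + g &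
  forall eps : R, 0 < eps -> ~ inP A b (x + (1 + eps) *: g)].

Lemma step_progress x : admissible x -> x <> y -> exists x',
  [/\ cstep x x' /\ inP A b x',
      offsum x' <= (1 - D%:R^-1) * offsum x,
      [/\ offsupp x' \subset offsupp x, small x' \subset small x & large x' \subset large x] &
      (potential x' < potential x)%N \/
      exists2 i, i \in small x & offsum x <= D%:R ^+ 2 * m%:R * kappa A * y i 0].
Proof.
move=> xad xy; have [xP Um] := xad; have [_ x0] := xP; have [_ y0] := yP.
have [D0 [g [gE gc gl]]] := exists_long_circuit xad xy.
have [a [i [a1 x'P gi ai]]] := exists_max_step xP gE gc.
have D1 : (1 : R) <= D%:R by rewrite ler1n.
have k1 := kappa_ge1 gE.
have phi0 := offsum_ge0 xP.
pose x' := x + a *: g.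
have x'E k : x' k 0 = x k 0 + a * g k 0 by rewrite !mxE.
have sg : 0 < - offsum g.
  have := circuit_le_offsum i xP gE gc; rewrite ltr0_norm // => H.
  have := lt_le_trans (_ : 0 < - g i 0) H; rewrite oppr_gt0 => /(_ gi).
  by rewrite pmulr_rgt0 //; lra.
have phiE : offsum x' = offsum x - a * - offsum g by rewrite offsumD offsumZ; ring.
have phi'0 := offsum_ge0 x'P; rewrite -/x' in x'P phi'0.
have phi_le : offsum x' <= (1 - D%:R^-1) * offsum x.
  have : - offsum g <= a * - offsum g by rewrite ler_peMl // ltW.
  have : D%:R^-1 * offsum x <= - offsum g by rewrite mulrC ler_pdivrMr ?(mulrC _ D%:R) //; lra.
  by rewrite phiE mulrBl mul1r; lra.
have phi_le1 : offsum x' <= offsum x.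
  by have := mulr_ge0 (ltW (lt_le_trans ltr01 a1)) (ltW sg); rewrite phiE; lra.
(* From f(x') >= 0: [a] times -f(g) is at most f(x), hence at most D times -f(g). *)
have aD : a <= D%:R by rewrite -(ler_pM2r sg); lra.
have offS : offsupp x' \subset offsupp x.
  apply/fintype.subsetP => k; rewrite !inE negbK x'E => /andP[/eqP yk H].
  rewrite yk eqxx; apply: contraNneq H => xk; rewrite xk add0r.
  have [_] := gc k; rewrite !mxE yk xk subr0 normr0 normr_le0 => /eqP ->.
  by rewrite mulr0.
have smallS : small x' \subset small x.
  apply/fintype.subsetP => k; rewrite !inE => /andP[-> yk] /=; apply: le_trans yk _.
  by rewrite ler_wpM2l //; lra.
have largeS : large x' \subset large x.
  apply/fintype.subsetP => k; rewrite !inE x'E => /andP[-> yk] /=; move: yk.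
  rewrite !ltNge; apply: contra => xk; have := y0 k => yk0.
  (* If [g_k >= 0], then [x'_k <= x_k + D (y_k - x_k) <= D y_k]; otherwise the coordinate does not
     increase. *)
  case: (conformalP k gc) => g1 g2.
    have h1 : a * g k 0 <= D%:R * g k 0 by rewrite ler_wpM2r.
    have h2 : D%:R * g k 0 <= D%:R * (y k 0 - x k 0) by rewrite ler_wpM2l // ler0n.
    have h3 : 0 <= (D%:R - 1) * x k 0 by rewrite mulr_ge0 // subr_ge0.
    by rewrite mulrBr in h2; rewrite mulrBl in h3; lra.
  have : a * g k 0 <= 0 by rewrite mulr_ge0_le0 //; lra.
  lra.
exists x'; split=> //.
  split=> //; exists (a *: g); split=> //.
    by apply: elementary_scale => //; rewrite gt_eqF //; lra.
  (* Any longer step makes coordinate [i] negative. *)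
  move=> eps eps0 [_ /(_ i)]; rewrite !mxE leNgt => /negP; apply.
  have -> : x i 0 + (1 + eps) * (a * g i 0) = (x i 0 + a * g i 0) + eps * a * g i 0 by ring.
  by rewrite ai add0r pmulr_rlt0 // mulr_gt0 //; lra.
have x'i : x' i 0 = 0 by rewrite x'E.
have leU := subset_leq_card offS; have leS := subset_leq_card smallS.
have leL := subset_leq_card largeS.
have gixi : y i 0 - x i 0 <= g i 0 by case: (conformalP i gc) => *; lra.
have [yi|yi] := eqVneq (y i 0) 0.
  left; suff : (#|offsupp x'| < #|offsupp x|)%N.
    by move=> ltU; rewrite /potential -2!addSn !leq_add.
  apply: proper_card; apply/fintype.properP; split=> //; exists i.
    by rewrite !inE negbK yi eqxx gt_eqF //; have := y0 i; lra.
  by rewrite !inE x'i eqxx andbF.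
have yi0 : 0 < y i 0 by rewrite lt_def yi y0.
have [xi|xi] := ltP (D%:R * y i 0) (x i 0).
  left; suff : (#|large x'| < #|large x|)%N.
    by move=> ltL; rewrite /potential -addnS !leq_add.
  apply: proper_card; apply/fintype.properP; split=> //; exists i.
    by rewrite !inE yi.
  by rewrite !inE x'i yi /= -leNgt mulr_ge0 ?ler0n // ltW.
(* Since [x'_i = 0], proximity at [x'] gives [y_i <= kappa f(x')], so [i] is small. *)
right; exists i.
  rewrite !inE yi /=.
  have := proximity i x'P; rewrite x'i sub0r normrN ger0_norm // => /le_trans; apply.
  by rewrite ler_wpM2l //; lra.
have gi_le : - g i 0 <= D%:R * y i 0 by lra.
(* At most m coordinates contribute to f(g), each at most [kappa |g_i|] in size. *)
have gN : - offsum g <= m%:R * (kappa A * - g i 0).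
  have -> : - offsum g = \sum_(j in offsupp x) - g j 0.
    rewrite /offsum -sumrN (bigID (mem (offsupp x))) /= [X in _ + X]big1 ?addr0.
      by apply: eq_bigl => j; rewrite !inE negbK; case: eqVneq.
    move=> j /andP[/eqP yj]; rewrite !inE negbK yj eqxx /= negbK => /eqP xj.
    have [_] := gc j; rewrite !mxE yj xj subr0 normr0 normr_le0 => /eqP ->.
    by rewrite oppr0.
  apply: (@le_trans _ _ (\sum_(j in offsupp x) (kappa A * - g i 0))).
    apply: ler_sum => j _; rewrite -(ltr0_norm gi).
    have [->|gj] := eqVneq (g j 0) 0; first by rewrite oppr0 mulr_ge0 //; lra.
    apply: le_trans (le_kappa gE (_ : j \in supp g) (_ : i \in supp g)).
    - by rewrite -normrN ler_norm.
    - by rewrite in_supp.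
    - by rewrite in_supp lt_eqF.
  rewrite sumr_const -[X in X <= _]mulr_natl; apply: ler_wpM2r; last by rewrite ler_nat.
  by rewrite mulr_ge0 //; lra.
apply: le_trans gl _.
have -> : D%:R ^+ 2 * m%:R * kappa A * y i 0 = D%:R * (m%:R * (kappa A * (D%:R * y i 0))) by ring.
rewrite ler_wpM2l ?ler0n //; apply: le_trans gN _.
by rewrite ler_wpM2l ?ler0n // ler_wpM2l //; lra.
Qed.

End Steps.

(** * Iterating steps until the target is reached *)

Section Reach.
Variables (m n : nat) (A : 'M[R]_(m, n)) (b : 'cV[R]_m) (y : 'cV[R]_n).
Variables (rkA : \rank A = m) (yv : vertex A b y).
Implicit Types g h z x w : 'cV[R]_n.
Let D : nat := (2 * minn m (n - m))%N.

(** A recursive form of circuit walks that is easy to concatenate. *)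
Fixpoint reach k x x' : Prop :=
  if k is k'.+1 then exists x1, [/\ inP A b x, cstep A b x x1 & reach k' x1 x']
  else inP A b x /\ x = x'.

Lemma reach_walk k x x' : reach k x x' ->
  exists xs, [/\ circuit_walk A b k xs, xs 0%N = x & xs k = x'].
Proof.
elim: k x => [|k IH] x /=.
  by case=> xP <-; exists (fun=> x); split=> //; split.
case=> x1 [xP [g [gE x1E gmax]]] /IH[xs [[xsP xsW] xs0 xsk]].
exists (fun i => if i is i'.+1 then xs i' else x); split=> //; split.
  by case=> // i ik; exact: xsP.
case=> [_|i ik]; last exact: xsW.
by exists g; rewrite xs0.
Qed.

Lemma reach_trans k l x x1 x2 : reach k x x1 -> reach l x1 x2 -> reach (k + l) x x2.
Proof.
elim: k x => [|k IH] x /=; first by case=> _ ->.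
by case=> x3 [xP x3S /IH H] /H xr; exists x3.
Qed.

(** Fewer than T steps occur only if the walk hits [y], where f is 0 and the decay bound is
    trivial. *)
Lemma iter_steps T x : admissible A b y x -> exists k x',
  [/\ (k <= T)%N /\ reach k x x', admissible A b y x',
      offsum y x' <= (1 - D%:R^-1) ^+ T * offsum y x &
      [/\ offsupp y x' \subset offsupp y x, small A y x' \subset small A y x &
          large m y x' \subset large m y x]].
Proof.
elim: T x => [|T IH] x xad.
  exists 0%N, x; rewrite /= expr0 mul1r; split=> //.
  by split=> //; split=> //; case: xad.
have [xy|xy] := pselect (x = y).
  exists 0%N, x; rewrite /=; split=> //; first by split=> //; split=> //; case: xad.
  by rewrite xy offsum_y mulr0.
have [D0 _] := exists_long_circuit rkA yv xad xy.
have [x1 [[x1S x1P] phi1 [sU sS sL] _]] := step_progress rkA yv xad xy.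
have x1ad : admissible A b y x1.
  by split=> //; apply: leq_trans xad.2; exact: subset_leq_card.
have [k [x' [[kT kr] x'ad phi' [sU' sS' sL']]]] := IH x1 x1ad.
exists k.+1, x'; split=> //.
- by split=> //=; exists x1; split=> //; case: xad.
- apply: le_trans phi' _; rewrite exprSr -mulrA ler_wpM2l // exprn_ge0 //.
  by rewrite subr_ge0 invf_le1 ?ler1n // ltr0n.
- by split; [exact: fintype.subset_trans sU | exact: fintype.subset_trans sS
            | exact: fintype.subset_trans sL].
Qed.

(** If the first step does not lower the potential, T more steps bring [kappa f] below [y_i], and
    [i] leaves [small]. *)
Lemma potential_drop T x : admissible A b y x -> x <> y ->
  (1 - D%:R^-1) ^+ T * (D%:R ^+ 2 * m%:R * kappa A ^+ 2) < 1 ->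
  exists k x', [/\ (k <= T.+1)%N, reach k x x', admissible A b y x' &
    (potential A y x' < potential A y x)%N].
Proof.
move=> xad xy Tbig.
have [D0 [g [gE _ _]]] := exists_long_circuit rkA yv xad xy.
have k1 := kappa_ge1 gE.
have [x1 [[x1S x1P] phi1 [sU sS sL] alt]] := step_progress rkA yv xad xy.
have x1ad : admissible A b y x1.
  by split=> //; apply: leq_trans xad.2; exact: subset_leq_card.
case: alt => [lt|[i iS iphi]].
  by exists 1%N, x1; split=> //=; exists x1; split=> //; case: xad.
have [k [x' [[kT kr] x'ad phi' [sU' sS' sL']]]] := iter_steps T x1ad.
exists k.+1, x'; split=> //; first by exists x1; split=> //; case: xad.
have lt : (#|small A y x'| < #|small A y x|)%N.
  apply: proper_card; apply/fintype.properP; split.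
    exact: fintype.subset_trans sS' sS.
  exists i => //; rewrite !inE negb_and -ltNge; apply/orP; right.
  have yi0 : 0 < y i 0.
    by move: iS; rewrite !inE lt_def => /andP[-> _]; exact: yv.1.2.
  have q0 : 0 <= 1 - D%:R^-1 :> R by rewrite subr_ge0 invf_le1 ?ler1n // ltr0n.
  have q1 : 1 - D%:R^-1 <= 1 :> R by rewrite gerBl invr_ge0 ler0n.
  have x0 := offsum_ge0 y xad.1.
  have phi2 : offsum y x' <= (1 - D%:R^-1) ^+ T * offsum y x.
    apply: le_trans phi' _; rewrite ler_wpM2l ?exprn_ge0 // (le_trans phi1) //.
    by rewrite ler_piMl.
  have h : kappa A * offsum y x' <=
      kappa A * ((1 - D%:R^-1) ^+ T * (D%:R ^+ 2 * m%:R * kappa A * y i 0)).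
    rewrite ler_wpM2l ?kappa_ge0 //; apply: le_trans phi2 _.
    by rewrite ler_wpM2l ?exprn_ge0.
  apply: le_lt_trans h _.
  have -> : kappa A * ((1 - D%:R^-1) ^+ T * (D%:R ^+ 2 * m%:R * kappa A * y i 0)) =
     ((1 - D%:R^-1) ^+ T * (D%:R ^+ 2 * m%:R * kappa A ^+ 2)) * y i 0.
    by set q := _ ^+ T; ring.
  by rewrite gtr_pMl.
rewrite /potential -addSn -addnS !leq_add // subset_leq_card //.
  exact: fintype.subset_trans sU.
exact: fintype.subset_trans sL.
Qed.

Lemma reach_target T x : admissible A b y x ->
  (1 - D%:R^-1) ^+ T * (D%:R ^+ 2 * m%:R * kappa A ^+ 2) < 1 ->
  exists k, (k <= T.+1 * potential A y x)%N /\ reach k x y.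
Proof.
move=> xad Tbig; have [p] := ubnP (potential A y x); elim: p x xad => // p IH x xad.
rewrite ltnS => xp; have [xy|xy] := pselect (x = y).
  by exists 0%N; split=> //=; split=> //; exact: xad.1.
have [k [x' [kT kr x'ad lt]]] := potential_drop xad xy Tbig.
have [l [lT lr]] := IH x' x'ad (leq_trans lt xp).
exists (k + l)%N; split; last exact: reach_trans kr lr.
apply: leq_trans (leq_add kT lT) _; rewrite -mulnS leq_mul2l lt orbT //.
Qed.

(** Each of the three sets lies in the support of [x] or of [y], which has at most m elements. *)
Lemma vertex_admissible x : vertex A b x ->
  admissible A b y x /\ (potential A y x <= 3 * m)%N.
Proof.
move=> xv; have sx := vertex_supp xv; have sy := vertex_supp yv.
have oU : (#|offsupp y x| <= m)%N.
  by apply: leq_trans sx; rewrite subset_leq_card // subDset finset.subsetUr.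
split; first by split=> //; exact: xv.1.
have sub P : (#|[set i in supp y | P i]| <= m)%N.
  by apply: leq_trans sy; apply/subset_leq_card/fintype.subsetP => i; rewrite inE => /andP[].
rewrite /potential 2!mulSn mul1n addnA !leq_add //; exact: sub.
Qed.

End Reach.

(** * Logarithmic estimates and the final bound *)

Lemma ln2_ge : 2^-1 <= ln 2 :> R.
Proof.
have := @le_ln1Dx R (- 2^-1); rewrite ltrN2 invf_lt1 ?ltr1n // => /(_ isT).
have -> : 1 - 2^-1 = 2^-1 :> R by lra.
by rewrite lnV ?lerN2 // posrE.
Qed.

(** By [1 - 1/D <= exp(-1/D)], any T above [D ln K] works; take the floor plus 1. *)
Lemma decay (D : nat) (K : R) : (0 < D)%N -> 1 <= K ->
  exists T : nat, (1 - D%:R^-1) ^+ T * K < 1 /\ T%:R <= D%:R * ln K + 1.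
Proof.
move=> D0 K1; have K0 : 0 < K by lra.
have lK : 0 <= ln K by rewrite ln_ge0.
have DR : 0 < D%:R :> R by rewrite ltr0n.
exists (Num.truncn (D%:R * ln K)).+1; set t := Num.truncn _; split; last first.
  by rewrite -natr1 lerD2r truncn_le mulr_ge0 // ltW.
have tK : ln K < t.+1%:R * D%:R^-1 by rewrite ltr_pdivlMr // mulrC truncnS_gt.
have q0 : 0 <= 1 - D%:R^-1 :> R by rewrite subr_ge0 invf_le1 ?ler1n.
have qe : (1 - D%:R^-1) ^+ t.+1 <= expR (- (t.+1%:R * D%:R^-1)) :> R.
  by rewrite -mulrN expRM_natl ler_pXn2r ?nnegrE ?expR_ge0 // expR_ge1Dx.
rewrite -ltr_pdivlMr // div1r; apply: le_lt_trans qe _.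
by rewrite expRN ltf_pV2 ?posrE ?expR_gt0 // -[X in X < _]lnK ?posrE // ltr_expR.
Qed.

Theorem theorem1p1 :
  exists C : R, 0 < C /\
    forall (m n : nat) (A : 'M[R]_(m, n)) (b : 'cV[R]_m),
      \rank A = m ->
      circuit_diameter_le A b
        (C * m%:R * (minn m (n - m))%:R * ln (m%:R + kappa A)).
Proof.
(* With [u = d ln s >= 1/2], [T + 1 <= 14 u + 2 <= 18 u]; the potential contributes another factor
   3m. *)
exists 54; split; first by rewrite ltr0n.
move=> m n A b rkA x y xv yv.
have [xad pot] := vertex_admissible yv xv.
have k0 := kappa_ge0 A.
have [<-|xy] := pselect (x = y).
  exists 0%N, (fun=> x); split=> //; first by split=> // i _; exact: xv.1.
  (* For m = 0 the bound is 0; otherwise the logarithm is nonnegative. *)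
  case: m A b rkA xv yv xad pot k0 => [|m] A b rkA xv yv xad pot k0.
    by rewrite mulr0 !mul0r.
  rewrite !mulr_ge0 ?ler0n // ln_ge0 //.
  by rewrite (le_trans (_ : 1 <= m.+1%:R)) ?ler1n // lerDl.
have [D0 [g [gE _ _]]] := exists_long_circuit rkA yv xad xy.
have k1 := kappa_ge1 gE.
set d := minn m (n - m) in D0 *; pose D := (2 * d)%N; rewrite -/D in D0.
have d0 : (0 < d)%N by move: D0; rewrite /D muln_gt0.
have m0 : (0 < m)%N by apply: leq_trans d0 (geq_minl _ _).
have dm : d%:R <= m%:R :> R by rewrite ler_nat geq_minl.
have mR : 1 <= m%:R :> R by rewrite ler1n.
have dR : 1 <= d%:R :> R by rewrite ler1n.
pose K : R := D%:R ^+ 2 * m%:R * kappa A ^+ 2.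
pose s : R := m%:R + kappa A.
have s2 : 2 <= s by rewrite /s; lra.
have s0 : 0 < s by lra.
have K1 : 1 <= K.
  by rewrite /K !mulr_ege1 ?exprn_ege1 ?ler1n.
(* [K] is a product of seven factors 2, 2, d, d, m, [kappa], [kappa], each at most [s]. *)
have Ks : K <= s ^+ 7.
  have -> : s ^+ 7 = (s ^+ 2 * s ^+ 2) * s * s ^+ 2 by ring.
  have sq c : 0 <= c -> c <= s -> c ^+ 2 <= s ^+ 2.
    by move=> c0 cs; rewrite ler_pXn2r ?nnegrE // ltW.
  rewrite /K /D natrM exprMn.
  rewrite !ler_pM ?mulr_ge0 ?exprn_ge0 ?sq ?ler0n //; rewrite /s; lra.
have lnK7 : ln K <= 7 * ln s.
  rewrite mulr_natl -lnXn // ler_ln ?posrE ?exprn_gt0 //; lra.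
have ls : 2^-1 <= ln s.
  by apply: le_trans ln2_ge _; rewrite ler_ln ?posrE //; lra.
have [T [Tbig Tle]] := decay D0 K1.
have [k [kle kr]] := reach_target rkA yv xad Tbig.
have [xs [xsW xs0 xsk]] := reach_walk kr.
exists k, xs; split=> //.
have kR : k%:R <= (T%:R + 1) * (3 * m%:R) :> R.
  rewrite natr1 -!natrM ler_nat; apply: leq_trans kle _.
  by rewrite leq_mul2l pot orbT.
apply: le_trans kR _.
have dl : 2^-1 <= d%:R * ln s by apply: (le_trans ls); rewrite ler_peMl //; lra.
have Dl : D%:R * ln K <= 14 * (d%:R * ln s).
  have -> : 14 * (d%:R * ln s) = D%:R * (7 * ln s) by rewrite /D natrM; ring.
  by rewrite ler_wpM2l ?ler0n.
have -> : 54 * m%:R * d%:R * ln s = (18 * (d%:R * ln s)) * (3 * m%:R) by ring.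
apply: ler_wpM2r; first by rewrite mulr_ge0 ?ler0n.
move: Tle dl Dl; move: (d%:R * ln s) (D%:R * ln K) T%:R => u v t. lra.
Qed.
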